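(* Fix a regime $d$ and a family $\mathcal Q$ of feasible transition sets. The value functions $\overline V_t^d,\underline V_t^d$ are computed exactly by the following backward recursion. At $t=T$, $\overline V_T^d(s)=\underline V_T^d(s)=y(s)$ for $s\in\mathcal S_T$. For $t=T-1,\dots,-1$ and every $s\in\mathcal S_t$, $$\overline V_t^d(s)=\max_{q\in\mathcal Q_t(s,d_t(s))}\ \sum_{s'\in\mathcal S_{t+1}(s,d_t(s))}q(s')\,\overline V_{t+1}^d(s'),$$ $$\underline V_t^d(s)=\min_{q\in\mathcal Q_t(s,d_t(s))}\ \sum_{s'\in\mathcal S_{t+1}(s,d_t(s))}q(s')\,\underline V_{t+1}^d(s').$$ Consequently, $\overline V_{-1}^d( * )=\bar\theta^d$ and $\underline V_{-1}^d( * )=\underline\theta^d$. When the root set is that of the default construction, $\mathcal Q_{-1}( *,\star)=\{P(S_0\in\cdot)\}$, the $t=-1$ instance reduces to $$\overline V_{-1}^d( * )=\sum_{s_0\in\mathcal S_0}P(s_0)\,\overline V_0^d(s_0),\qquad \underline V_{-1}^d( * )=\sum_{s_0\in\mathcal S_0}P(s_0)\,\underline V_0^d(s_0).$$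
   Context: **Spaces.** Fix $T\ge 1$, finite state spaces $\mathcal S_0,\dots,\mathcal S_T$, a finite treatment space $\mathcal A$, a finite outcome space $\mathcal Y\subseteq\mathbb R$ and a known map $y:\mathcal S_T\to\mathcal Y$; $Y=y(S_T)$. A regime is $d=(d_0,\dots,d_{T-1})$ with $d_t:\mathcal S_t\to\mathcal A$. $\Delta(X)$ is the set of probability distributions on a finite set $X$; distributions on a subset are extended by zero. **Model and true kernels.** A structural causal model (SCM) $M$ has mutually independent exogenous variables $\varepsilon_0^S$, $\varepsilon_t^U,\varepsilon_t^A,\varepsilon_{t+1}^S$ ($0\le t\le T-1$) and equations $S_0=f_0^S(\varepsilon_0^S)$, $U_t=f_t^U(\varepsilon_t^U)$, $A_t=f_t^A(S_t,U_t,\varepsilon_t^A)$, $S_{t+1}=f_{t+1}^S(S_t,A_t,U_t,\varepsilon_{t+1}^S)$, with $S_t\in\mathcal S_t$, $A_t\in\mathcal A$. Its structural transition kernel is $\kappa_{M,t}(\cdot\mid s,a)=$ law of $f_{t+1}^S(s,a,U_t,\varepsilon_{t+1}^S)$ for fixed $(s,a)$. A family $\mathbf S$ of nonempty sets $\mathcal S_{t+1}(s,a)\subseteq\mathcal S_{t+1}$ ($0\le t\le T-1$, $s\in\mathcal S_t$, $a\in\mathcal A$) is fixed, and $f_{t+1}^S(s,a,\cdot,\cdot)$ takes values in $\mathcal S_{t+1}(s,a)$. A graph $G$ specifies at which steps $t$ a bidirected edge $A_t\leftrightarrow S_{t+1}$ is present; where it is absent, $U_t$ may not enter both the $A_t$-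 and $S_{t+1}$-equations. The data are generated by a fixed true SCM $M^\star$ satisfying all these requirements, with observational law $P$ (the law of $(S_0,A_0,\dots,A_{T-1},S_T)$). Write $\kappa_t=\kappa_{M^\star,t}$ for $t\ge 0$. **Root convention.** $\mathcal S_{-1}=\{*\}$, $\mathcal A_{-1}=\{\star\}$, $d_{-1}( * )=\star$, $\mathcal S_0( *,\star)=\mathcal S_0$, $\kappa_{-1}(\cdot\mid *,\star)=P(S_0\in\cdot)$; $\mathcal A_t=\mathcal A$ for $t\ge 0$. **Family of feasible transition sets.** $\mathcal Q=\{\mathcal Q_t(s,a): t=-1,\dots,T-1,\ s\in\mathcal S_t,\ a\in\mathcal A_t\}$, where each $\mathcal Q_t(s,a)\subseteq\Delta(\mathcal S_{t+1}(s,a))$ is nonempty, compact, convex and satisfies $\kappa_t(\cdot\mid s,a)\in\mathcal Q_t(s,a)$. **Ambiguity set and bounds.** $\mathcal P^d(\mathcal Q)$ is the set of distributions $Q$ on trajectories $\mathbf v=(s_0,a_0,\dots,a_{T-1},s_T)$ of the form $$Q(\mathbf v)=q_{-1}(s_0\mid *,\star)\prod_{t=0}^{T-1}\mathbf 1\{a_t=d_t(s_t)\}\,q_t(s_{t+1}\mid s_t,a_t),$$ with $q_t(\cdot\mid s,d_t(s))\in\mathcal Q_t(s,d_t(s))$ for all $t=-1,\dots,T-1$, $s\in\mathcal S_t$. Put $\bar\theta^d=\sup_{Q\in\mathcal P^d(\mathcal Q)}\mathbb E^Q[Y]$, $\underline\theta^d=\inf_{Q\in\mathcal P^d(\mathcal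 Q)}\mathbb E^Q[Y]$. **Value functions.** For $t\in\{-1,\dots,T-1\}$ and $s\in\mathcal S_t$, $\mathcal P_t^d(s;\mathcal Q)$ is the set of laws of $(S_{t+1},\dots,S_T)$ of the form $Q(s_{t+1},\dots,s_T)=\prod_{k=t}^{T-1}q_k(s_{k+1}\mid s_k,d_k(s_k))$ with $s_t:=s$ and $q_k(\cdot\mid x,d_k(x))\in\mathcal Q_k(x,d_k(x))$ for all $k=t,\dots,T-1$, $x\in\mathcal S_k$. Set $\mathcal P_T^d(s;\mathcal Q)=\{\delta_s\}$. For $t=-1,\dots,T$, $\overline V_t^d(s)=\sup_{Q\in\mathcal P_t^d(s;\mathcal Q)}\mathbb E^Q[Y]$ and $\underline V_t^d(s)=\inf_{Q\in\mathcal P_t^d(s;\mathcal Q)}\mathbb E^Q[Y]$. *)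

(* Defs.v *)
From HB Require Import structures.
From mathcomp Require Import all_boot all_order all_algebra.
From mathcomp Require Import all_classical all_reals all_analysis.

Set Implicit Arguments.
Unset Strict Implicit.
Unset Printing Implicit Defensive.

Import Order.TTheory GRing.Theory Num.Theory.
Import numFieldNormedType.Exports.

Local Open Scope classical_set_scope.
Local Open Scope ring_scope.

(** State spaces are given as [S : nat -> finType]; with horizon [T], only
    [S 0], ..., [S T] matter, and every time-indexed datum is likewise only
    constrained and used up to [T].

    Decision times t = -1, 0, ..., T-1 are shifted by one: stage [n] is time
    t = n - 1.  Thus [stage_state S n] is the state space at time n - 1 (the
    singleton {*} for n = 0), and the transition of stage [n] leads into [S n]. *)

Definition stage_state (S : nat -> finType) (n : nat) : finType :=
  if n is m.+1 then S m else unit.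

Definition stage_action (A : finType) (n : nat) : finType :=
  if n is _.+1 then A else unit.

Definition src (T : nat) (t : 'I_T) : 'I_T.+1 := widen_ord (leqnSn T) t.
Definition tgt (T : nat) (t : 'I_T) : 'I_T.+1 := Ordinal (ltn_ord t : t.+1 < T.+1)%N.

Definition is_max (R : realType) (E : set R) (m : R) : Prop := E m /\ ubound E m.
Definition is_min (R : realType) (E : set R) (m : R) : Prop := E m /\ lbound E m.

Section Distributions.
Variables (R : realType) (X : finType).

Definition Delta : set (X -> R) :=
  [set p | (forall x, 0 <= p x) /\ \sum_x p x = 1].

Definition Delta_on (B : {set X}) : set (X -> R) :=
  [set p | Delta p /\ forall x, x \notin B -> p x = 0].

Definition expect (p f : X -> R) : R := \sum_x p x * f x.

Definition point_mass (x0 : X) : X -> R := fun x => (x == x0)%:R.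

End Distributions.

Record scm (R : realType) (T : nat) (A : finType) (S : nat -> finType) := SCM {
  disp : measure_display;
  Omega : measurableType disp;
  Pr : probability Omega R;
  (* value spaces of the exogenous variables and of U_t *)
  dE0 : measure_display; E0 : measurableType dE0;
  dEU : nat -> measure_display; EU : forall t, measurableType (dEU t);
  dEA : nat -> measure_display; EA : forall t, measurableType (dEA t);
  dES : nat -> measure_display; ES : forall t, measurableType (dES t);
  dU : nat -> measure_display; Usp : forall t, measurableType (dU t);
  (* [epsS t] is the noise of S_(t+1) *)
  eps0 : Omega -> E0;
  epsU : forall t, Omega -> EU t;
  epsA : forall t, Omega -> EA t;
  epsS : forall t, Omega -> ES t;
  (* [fS t] is the equation of S_(t+1) *)
  f0 : E0 -> S 0;
  fU : forall t, EU t -> Usp t;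
  fA : forall t, S t -> Usp t -> EA t -> A;
  fS : forall t, S t -> A -> Usp t -> ES t -> S t.+1;
  meas_eps0 : measurable_fun setT eps0;
  meas_epsU : forall t, (t < T)%N -> measurable_fun setT (@epsU t);
  meas_epsA : forall t, (t < T)%N -> measurable_fun setT (@epsA t);
  meas_epsS : forall t, (t < T)%N -> measurable_fun setT (@epsS t);
  meas_f0 : forall s, measurable [set e | f0 e = s];
  meas_fU : forall t, (t < T)%N -> measurable_fun setT (@fU t);
  meas_fA : forall t, (t < T)%N -> forall s a,
    measurable [set ue : Usp t * EA t | fA s ue.1 ue.2 = a];
  meas_fS : forall t, (t < T)%N -> forall s a s',
    measurable [set ue : Usp t * ES t | fS s a ue.1 ue.2 = s'];
  (* mutual independence; subfamilies are obtained by taking some sets full *)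
  indep : forall (B0 : set E0) (BU : forall t, set (EU t))
                 (BA : forall t, set (EA t)) (BS : forall t, set (ES t)),
    measurable B0 ->
    (forall t, (t < T)%N ->
      [/\ measurable (BU t), measurable (BA t) & measurable (BS t)]) ->
    Pr [set w | B0 (eps0 w) /\
          forall t, (t < T)%N -> [/\ BU t (epsU t w), BA t (epsA t w)
                                   & BS t (epsS t w)]] =
    (Pr (eps0 @^-1` B0) *
     \prod_(t < T) (Pr (@epsU t @^-1` BU t) * Pr (@epsA t @^-1` BA t)
                    * Pr (@epsS t @^-1` BS t)))%E
}.

Section CausalModel.
Variables (R : realType) (T : nat) (A : finType) (S : nat -> finType).

Definition trajectory : finType :=
  ({dffun forall t : 'I_T.+1, S t} * {ffun 'I_T -> A})%type.

Variable M : scm R T A S.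

Definition U (t : nat) (w : Omega M) : Usp M t := @fU _ _ _ _ M t (epsU t w).

Fixpoint S_ (t : nat) (w : Omega M) : S t :=
  match t return S t with
  | 0 => f0 (eps0 w)
  | t'.+1 => fS (S_ t' w) (fA (S_ t' w) (U t' w) (epsA t' w))
               (U t' w) (epsS t' w)
  end.

Definition A_ (t : nat) (w : Omega M) : A := fA (S_ t w) (U t w) (epsA t w).

Definition sample_path (w : Omega M) : trajectory :=
  ([ffun t : 'I_T.+1 => S_ t w], [ffun t : 'I_T => A_ t w]).

Definition obs_law (v : trajectory) : R := fine (Pr M [set w | sample_path w = v]).

(* P(S_0 = s0), a marginal of the observational law *)
Definition obs_S0 (s0 : S 0) : R := \sum_(v : trajectory | v.1 ord0 == s0) obs_law v.

Definition struct_kernel (t : nat) (s : S t) (a : A) (s' : S t.+1) : R :=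
  fine (Pr M [set w | fS s a (U t w) (epsS t w) = s']).

Definition stage_kernel (n : nat) :
    stage_state S n -> stage_action A n -> S n -> R :=
  match n return stage_state S n -> stage_action A n -> S n -> R with
  | 0 => fun _ _ => obs_S0
  | t.+1 => fun s a => @struct_kernel t s a
  end.

Definition respects_supports (supp : forall t, S t -> A -> {set S t.+1}) : Prop :=
  forall t, (t < T)%N -> forall s a (u : Usp M t) (e : ES M t),
    fS s a u e \in supp t s a.

(* [G t] says that the bidirected edge A_t <-> S_(t+1) is present *)
Definition respects_graph (G : nat -> bool) : Prop :=
  forall t, (t < T)%N -> ~~ G t ->
    (forall s (u u' : Usp M t) (e : EA M t), fA s u e = fA s u' e) \/
    (forall s a (u u' : Usp M t) (e : ES M t), fS s a u e = fS s a u' e).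

End CausalModel.

Section Bounds.
Variables (R : realType) (T : nat) (A : finType) (S : nat -> finType).

Definition stage_supp (supp : forall t, S t -> A -> {set S t.+1}) (n : nat) :
    stage_state S n -> stage_action A n -> {set S n} :=
  match n return stage_state S n -> stage_action A n -> {set S n} with
  | 0 => fun _ _ => [set: S 0]%SET
  | t.+1 => fun s a => supp t s a
  end.

Definition stage_regime (d : forall t, S t -> A) (n : nat) :
    stage_state S n -> stage_action A n :=
  match n return stage_state S n -> stage_action A n with
  | 0 => fun _ => tt
  | t.+1 => fun s => d t s
  end.

Definition kernels : Type :=
  forall n, stage_state S n -> stage_action A n -> S n -> R.

Definition set_family : Type :=
  forall n, stage_state S n -> stage_action A n -> set (S n -> R).

(* [kappa] is the family of true kernels *)
Definition feasible_family (supp : forall t, S t -> A -> {set S t.+1})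
    (kappa : kernels) (Q : set_family) : Prop :=
  forall n, (n <= T)%N -> forall (s : stage_state S n) (a : stage_action A n),
    [/\ Q n s a `<=` Delta_on (stage_supp supp s a),
        Q n s a !=set0,
        compact (Q n s a : set {ptws S n -> R}),
        convex_set (Q n s a : set (convex_lmodType (S n -> R^o)))
      & Q n s a (kappa n s a)].

Variables (d : forall t, S t -> A) (Q : set_family).
Let d' := stage_regime d.

(* admissible from stage [n0] on *)
Definition admissible (n0 : nat) (q : kernels) : Prop :=
  forall n, (n0 <= n <= T)%N -> forall s : stage_state S n,
    @Q n s (d' s) (q n s (d' s)).

Definition traj_law (q : kernels) (v : trajectory T A S) : R :=
  q 0 tt tt (v.1 ord0) *
  \prod_(t < T) ((v.2 t == d (v.1 (src t)))%:R *
                 q t.+1 (v.1 (src t)) (v.2 t) (v.1 (tgt t))).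

Definition ambiguity_set : set (trajectory T A S -> R) :=
  [set p | Delta p /\ exists2 q, admissible 0 q & p =1 traj_law q].

(* values of (S_n, ..., S_T), i.e. of (S_(t+1), ..., S_T) for t = n - 1 *)
Definition tail (n : nat) : finType :=
  {dffun forall j : {j : 'I_T.+1 | (n <= j)%N}, S (val j)}.

(* prod_(k = t)^(T-1) q_k(s_(k+1) | s_k, d_k(s_k)) with s_t = s; the factor
   k = t, whose source is [s], is written separately *)
Definition tail_law (n : 'I_T.+1) (s : stage_state S n) (q : kernels)
    (v : tail n) : R :=
  q n s (d' s) (v (exist _ n (leqnn n))) *
  \prod_(k : {k : 'I_T | (n <= k)%N})
     let sk : S (val k) := v (exist _ (src (val k)) (valP k)) in
     q (val k).+1 sk (d sk) (v (exist _ (tgt (val k)) (leqW (valP k)))).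

Definition tail_laws (n : 'I_T.+1) (s : stage_state S n) : set (tail n -> R) :=
  [set p | Delta p /\ exists2 q, admissible n q & p =1 tail_law s q].

Definition terminal_laws (s : S T) : set (S T -> R) := [set point_mass R s].

Variable y : S T -> R.

Definition traj_outcome (v : trajectory T A S) : R := y (v.1 ord_max).

Definition tail_outcome (n : 'I_T.+1) (v : tail n) : R :=
  y (v (exist _ ord_max (ltn_ord n))).

Definition theta_up : R := sup [set expect p traj_outcome | p in ambiguity_set].
Definition theta_low : R := inf [set expect p traj_outcome | p in ambiguity_set].

(* the value functions at time t = n - 1 < T *)
Definition V_up (n : 'I_T.+1) (s : stage_state S n) : R :=
  sup [set expect p (@tail_outcome n) | p in tail_laws s].
Definition V_low (n : 'I_T.+1) (s : stage_state S n) : R :=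
  inf [set expect p (@tail_outcome n) | p in tail_laws s].

(* the value functions at time t = T *)
Definition V_up_T (s : S T) : R := sup [set expect p y | p in terminal_laws s].
Definition V_low_T (s : S T) : R := inf [set expect p y | p in terminal_laws s].

(* values sum_(s' in S_(t+1)(s, d_t(s))) q(s') W(s') over q in Q_t(s, d_t(s)),
   for a continuation value [W], t = n - 1 *)
Definition stage_values (supp : forall t, S t -> A -> {set S t.+1}) (n : nat)
    (s : stage_state S n) (W : S n -> R) : set R :=
  [set \sum_(s' in stage_supp supp s (d' s)) q s' * W s' | q in @Q n s (d' s)].

End Bounds.

(* Main.v *)
(* The expected outcome from stage [n] on is a one-step expectation of the
   expected outcome from stage [n + 1] on, whose remaining kernels do not depend
   on the kernel chosen at stage [n].  As the feasible sets are imposed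
   separately for each stage and state, a kernel optimal from stage [n + 1] on
   for all states at once can be completed by a maximiser at each state of stage
   [n], which exists by compactness.  The lower values are the upper values of
   [- y]. *)
Require Import Defs.
From mathcomp Require Import all_boot all_order all_algebra.
From mathcomp Require Import all_classical all_reals all_analysis.

Set Implicit Arguments.
Unset Strict Implicit.
Unset Printing Implicit Defensive.

Import Order.TTheory GRing.Theory Num.Theory.
Import numFieldNormedType.Exports.

Local Open Scope classical_set_scope.
Local Open Scope ring_scope.

(** * Backward induction on time, and sums over tails of the state path *)

Section TailSums.
Variables (R : realType) (T : nat) (S : nat -> finType).

(** Induction on the number [T - m] of remaining stages, stated with [src] and [tgt] to match the
    recursions for tail laws. *)
Lemma stage_ind (P : 'I_T.+1 -> Prop) :
  P ord_max -> (forall t : 'I_T, P (tgt t) -> P (src t)) -> forall n, P n.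
Proof.
move=> PT Pstep [m lemT].
move: {2}(T - m)%N (erefl (T - m)%N) => k; elim: k m lemT => [|k IHk] m lemT mk.
  suff -> : Ordinal lemT = ord_max by [].
  by apply/val_inj/eqP; rewrite eqn_leq -ltnS lemT /= -subn_eq0 mk.
have ltmT : (m < T)%N by rewrite -subn_gt0 mk.
have -> : Ordinal lemT = src (Ordinal ltmT) by exact: val_inj.
by apply/Pstep/IHk; rewrite subnS mk.
Qed.

Lemma lt_of_le_neq (n j : nat) : (n <= j)%N -> n <> j -> (n < j)%N.
Proof. by rewrite leq_eqVlt => /predU1P[]. Qed.

(** The type of a coordinate depends on its index, so the new head [s] has to be transported along a
    proof of [n = val j]. *)
Definition tail_cons (n : nat) (s : S n) (w : tail T S n.+1) : tail T S n :=
  [ffun j : {j : 'I_T.+1 | (n <= j)%N} =>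
    match @eqP _ n (val j) with
    | ReflectT e => ecast k (S k) e s
    | ReflectF ne => w (exist _ (val j) (lt_of_le_neq (valP j) ne))
    end].

(** Equality proofs on [nat] are unique, so the transport at index [n] is trivial. *)
Lemma tail_consE0 (n : 'I_T.+1) (s : S n) (w : tail T S n.+1) p :
  tail_cons s w (exist _ n p) = s.
Proof. by rewrite ffunE /=; case: eqP => // e; rewrite eq_axiomK. Qed.

Lemma tail_consES (n : nat) (s : S n) (w : tail T S n.+1) (j : 'I_T.+1) p p' :
  tail_cons s w (exist _ j p) = w (exist _ j p').
Proof.
rewrite ffunE /=; case: eqP => [e|ne].
  by have := p'; rewrite {1}e ltnn.
by rewrite (bool_irrelevance (lt_of_le_neq _ _) p').
Qed.

(** [tail_cons] is a bijection; its inverse separates the coordinate [n] of a tail from the later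
    ones. *)
Lemma sum_tail (n : 'I_T.+1) (F : tail T S n -> R) :
  \sum_v F v = \sum_(s : S n) \sum_(w : tail T S n.+1) F (tail_cons s w).
Proof.
rewrite pair_bigA /= (reindex (fun p => tail_cons p.1 p.2)) //=.
exists (fun v => (v (exist _ n (leqnn n)),
  [ffun j : {j : 'I_T.+1 | (n < j)%N} => v (exist _ (val j) (ltnW (valP j)))])).
  move=> [s w] _ /=; congr pair; first exact: tail_consE0.
  apply/ffunP => -[j p]; rewrite ffunE /=; exact: tail_consES.
move=> v _; apply/ffunP => -[j p] /=.
have [e|ne] := eqVneq n j.
  case: j / e p => p; rewrite tail_consE0.
  by rewrite (bool_irrelevance (leqnn _) p).
have p' : (n < j)%N by rewrite ltn_neqAle ne.
by rewrite (tail_consES _ _ _ p') ffunE /= (bool_irrelevance (ltnW _) p).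
Qed.

End TailSums.

(** * One-step factorisation of tail laws and of trajectory laws *)

Section TailLaws.
Variables (R : realType) (T : nat) (A : finType) (S : nat -> finType).
Variable d : forall t, S t -> A.
Local Notation kernels := (kernels R A S).

Lemma tail_law_cons (t : 'I_T) (q : kernels) (s : stage_state S t) (s' : S t)
    (w : tail T S t.+1) :
  tail_law d (n := src t) s q (tail_cons (n := t) s' w) =
  q t s (stage_regime d s) s' * tail_law d (n := tgt t) s' q w.
Proof.
have E0 p : tail_cons (n := t) s' w (exist _ (src t) p) = s'.
  exact: (@tail_consE0 _ _ (src t)).
have ES j p p' : tail_cons (n := t) s' w (exist _ j p) = w (exist _ j p').
  exact: tail_consES.
rewrite /tail_law E0 /=; congr (_ * _).
(* The factor [k = t] is the leading factor of the shorter law; the other indices satisfy [t < k]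
   and are matched with its product. *)
rewrite (bigD1 (exist _ t (leqnn t))) //=; congr (_ * _).
  by rewrite !E0 (ES (tgt t) _ (leqnn t.+1)).
rewrite (reindex_omap (fun k : {k : 'I_T | (t < k)%N} =>
    exist _ (val k) (ltnW (valP k)) : {k : 'I_T | (t <= k)%N})
  (fun k => insub (val k))) /=; last first.
  move=> [k p] /eqP ne; have p' : (t < k)%N.
    rewrite ltn_neqAle p andbT; apply/eqP => e; apply: ne; exact/val_inj/val_inj.
  by rewrite insubT /=; congr Some; exact: val_inj.
apply: eq_big => [[k p]|k _] /=.
  rewrite insubT /=; apply/andP; split; last exact/eqP/congr1/val_inj.
  by apply/eqP => -[e]; move: p; rewrite e ltnn.
by rewrite !(ES (src (val k)) _ (valP k)) (ES (tgt (val k)) _ (leqW (valP k))).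
Qed.

(** The tower property, conditioning on the first state of the tail. *)
Lemma expect_tail_law_src (t : 'I_T) (q : kernels) (s : stage_state S t)
    (g : S T -> R) :
  expect (tail_law d (n := src t) s q) (tail_outcome g (n := src t)) =
  expect (q t s (stage_regime d s))
    (fun s' => expect (tail_law d (n := tgt t) s' q) (tail_outcome g (n := tgt t))).
Proof.
rewrite /expect (sum_tail (n := src t)); apply: eq_bigr => s' _.
rewrite mulr_sumr; apply: eq_bigr => w _.
rewrite tail_law_cons -mulrA; congr (_ * (_ * _)).
congr g; exact: (@tail_consES _ _ t s' w ord_max).
Qed.

Lemma expect_tail_law_max (q : kernels) (s : stage_state S T) (g : S T -> R) :
  expect (tail_law d (n := ord_max) s q) (tail_outcome g (n := ord_max)) =
  expect (q T s (stage_regime d s)) g.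
Proof.
(* No coordinate lies beyond [T], so exactly one tail starts at [T.+1] and the inner sum has a
   single term. *)
have empty (j : {j : 'I_T.+1 | (T < j)%N}) : False.
  by case: j => j; rewrite ltnNge -ltnS ltn_ord.
pose w0 : tail T S T.+1 := [ffun j => False_rect _ (empty j)].
rewrite /expect (sum_tail (n := ord_max)); apply: eq_bigr => s' _.
rewrite (big_pred1 w0) => [|w]; last first.
  by apply/esym/eqP/ffunP => j; case: (empty j).
have E0 p : tail_cons (n := T) s' w0 (exist _ ord_max p) = s'.
  exact: (@tail_consE0 _ _ ord_max).
rewrite /tail_law /tail_outcome !E0 big1 ?mulr1 // => -[k kT] _.
by have := kT; rewrite leqNgt ltn_ord.
Qed.

Lemma eq_tail_law (n : 'I_T.+1) (s : stage_state S n) (q q' : kernels) :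
  (forall k, (n <= k)%N -> q k = q' k) -> tail_law d s q =1 tail_law d s q'.
Proof.
move=> qq' v; rewrite /tail_law qq' //; congr (_ * _).
by apply: eq_bigr => -[k nk] _ /=; rewrite qq' // leqW.
Qed.

(** The outcome ignores the actions, so they can be summed out; a tail from stage 0 is the full
    state path up to reindexing. *)
Lemma traj_law_expect (q : kernels) (g : S T -> R) :
  expect (traj_law d q) (traj_outcome g) =
  expect (tail_law d (n := ord0) tt q) (tail_outcome g (n := ord0)).
Proof.
pose drop (v : {dffun forall t : 'I_T.+1, S t}) : tail T S 0 :=
  [ffun j : {j : 'I_T.+1 | (0 <= j)%N} => v (val j)].
pose lift (v : tail T S 0) : {dffun forall t : 'I_T.+1, S t} :=
  [ffun j : 'I_T.+1 => v (exist _ j (leq0n j))].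
rewrite /expect [RHS](reindex drop) /=; last first.
  exists lift => v _; apply/ffunP.
    by move=> j; rewrite !ffunE.
  move=> [j p]; rewrite !ffunE /=.
  by rewrite (bool_irrelevance (leq0n j) p).
rewrite -(pair_bigA _ (fun x a => traj_law d q (x, a) * traj_outcome g (x, a))) /=.
apply: eq_bigr => x _; rewrite /traj_outcome /tail_outcome /= ffunE -mulr_suml.
congr (_ * _); rewrite /traj_law /tail_law /= ffunE -mulr_sumr; congr (_ * _).
(* Distributivity turns the sum over action sequences into a product of one-stage sums, where the
   indicator keeps only the action of the regime. *)
rewrite -(bigA_distr_bigA (fun t a => (a == d (x (src t)))%:R *
  q t.+1 (x (src t)) a (x (tgt t)))) /=.
rewrite [RHS](reindex (fun t : 'I_T =>
    exist _ t (leq0n t) : {k : 'I_T | (0 <= k)%N})) /=; last first.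
  exists val => // -[t p] _; exact: val_inj.
apply: eq_bigr => t _; rewrite !ffunE /=.
rewrite (bigD1 (d (x (src t)))) //= eqxx mul1r big1 ?addr0 // => a /negPf ->.
by rewrite mul0r.
Qed.
End TailLaws.

(** * Suprema, infima and maximisation of expectations *)

Section Optimisation.
Variable R : realType.

Lemma sup_is_max (E : set R) (m : R) : is_max E m -> sup E = m.
Proof.
move=> [Em ubm]; apply/eqP; rewrite eq_le ge_sup//; last by exists m.
by apply: ub_le_sup => //; exists m.
Qed.

Lemma expectN (X : finType) (p f : X -> R) :
  expect p (fun x => - f x) = - expect p f.
Proof. by rewrite -sumrN; apply: eq_bigr => x _; rewrite mulrN. Qed.

Lemma inf_expect (X : finType) (P : set (X -> R)) (f : X -> R) :
  inf [set expect p f | p in P] = - sup [set expect p (fun x => - f x) | p in P].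
Proof.
rewrite /inf image_comp; congr (- sup _).
by apply: eq_imagel => p _ /=; rewrite expectN.
Qed.

Lemma expect_le (X : finType) (p f g : X -> R) :
  Delta p -> (forall x, f x <= g x) -> expect p f <= expect p g.
Proof. by move=> [p0 _] fg; apply: ler_sum => x _; exact: ler_wpM2l. Qed.

(** Evaluations at points are continuous for the pointwise topology, hence so is the finite sum
    [expect p W] in [p], and the extreme value theorem applies. *)
Lemma compact_expect_max (X : finType) (C : set (X -> R)) (W : X -> R) :
  C !=set0 -> compact (C : set {ptws X -> R}) ->
  exists2 q, C q & forall p, C p -> expect p W <= expect q W.
Proof.
move=> C0 cC.
have addC : continuous (fun x : R^o * R^o => x.1 + x.2) by exact: add_continuous.
have px x : continuous (fun p : {ptws X -> R} => p x).
  exact: (@proj_continuous X (fun=> R) x).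
have cterm x : continuous (fun p : {ptws X -> R} => p x * W x).
  move=> p; exact: (continuous_comp (px x p) (@mulrr_continuous R (W x) (p x))).
have cW := @continuous_big R X _ 0 xpredT addC {ptws X -> R} (index_enum X)
  (fun x p => p x * W x) (fun x _ => cterm x).
have [q] := @compact_EVT_max {ptws X -> R} R _ C C0 cC
  (continuous_subspaceT cW).
rewrite inE => Cq qmax; exists q => // p Cp.
by apply: qmax; rewrite inE.
Qed.

End Optimisation.

(** * Attainment of the upper values and their backward recursion *)

Section Bellman.
Variables (R : realType) (T : nat) (A : finType) (S : nat -> finType).
Variables (supp : forall t, S t -> A -> {set S t.+1}) (kappa : kernels R A S).
Variables (d : forall t, S t -> A) (Q : set_family R A S).
Hypothesis feasibleQ : feasible_family T supp kappa Q.
Local Notation kernels := (kernels R A S).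

Let d' := stage_regime d.

Lemma admissible_Delta (m n : nat) (q : kernels) (s : stage_state S n) :
  admissible T d Q m q -> (m <= n <= T)%N -> Delta (q n s (d' s)).
Proof.
move=> qm mnT; have /andP[_ nT] := mnT.
by have [sub _ _ _ _] := feasibleQ nT s (d' s); have [] := sub _ (qm _ mnT s).
Qed.

Lemma admissible_leq (m n : nat) (q : kernels) :
  (m <= n)%N -> admissible T d Q m q -> admissible T d Q n q.
Proof.
move=> mn qm k /andP[nk kT]; apply: qm; by rewrite kT (leq_trans mn).
Qed.

(** Total mass written as the expectation of the constant 1, so that the one-step recursion computes
    it. *)
Lemma expect_tail_law1 (n : 'I_T.+1) (s : stage_state S n) (q : kernels) :
  admissible T d Q n q ->
  expect (tail_law d s q) (tail_outcome (fun=> 1) (n := n)) = 1.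
Proof.
have expect1 (X : finType) (p : X -> R) : Delta p -> expect p (fun=> 1) = 1.
  by move=> [_ p1]; rewrite -[RHS]p1; apply: eq_bigr => x _; rewrite mulr1.
elim/stage_ind: n s => [|t IHt] s qn.
  by rewrite expect_tail_law_max expect1 //; apply: (admissible_Delta s qn); rewrite /= leqnn.
rewrite expect_tail_law_src -[RHS](expect1 _ (q t s (d' s))).
  apply: eq_bigr => s' _; rewrite IHt //; exact: admissible_leq qn.
by apply: (admissible_Delta s qn); rewrite leqnn (ltnW (ltn_ord t)).
Qed.

Lemma tail_law_Delta (n : 'I_T.+1) (s : stage_state S n) (q : kernels) :
  admissible T d Q n q -> Delta (tail_law d s q).
Proof.
move=> qn; split=> [v|].
  apply: mulr_ge0; first by apply: (admissible_Delta s qn _).1; rewrite leqnn -ltnS ltn_ord.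
  apply: prodr_ge0 => -[k nk] _ /=.
  by apply: (admissible_Delta (n := k.+1) _ qn _).1; rewrite leqW ?ltn_ord.
rewrite -[RHS](expect_tail_law1 s qn).
by apply: eq_bigr => v _; rewrite mulr1.
Qed.

Lemma traj_law_Delta (q : kernels) :
  admissible T d Q 0 q -> Delta (traj_law (T := T) d q).
Proof.
move=> q0; split=> [v|].
  apply: mulr_ge0; first exact: (admissible_Delta (n := 0) tt q0 _).1.
  (* Admissibility constrains the kernel only at the action of the regime; at any other action the
     indicator makes the factor zero. *)
  apply: prodr_ge0 => t _; case: eqP => [->|_]; last by rewrite mul0r.
  by rewrite mul1r; apply: (admissible_Delta (n := t.+1) _ q0 _).1; rewrite /= ltn_ord.
rewrite -[RHS](expect_tail_law1 (n := ord0) tt q0) -traj_law_expect.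
by apply: eq_bigr => v _; rewrite mulr1.
Qed.

(** Admissibility already makes [tail_law] a distribution, so the optimisation runs over kernels
    alone. *)
Lemma tail_values (n : 'I_T.+1) (s : stage_state S n) (g : S T -> R) :
  [set expect p (tail_outcome g (n := n)) | p in tail_laws d Q s] =
  [set expect (tail_law d s q) (tail_outcome g (n := n)) | q in admissible T d Q n].
Proof.
rewrite eqEsubset; split=> [_ [p [_ [q qn pq]] <-]|_ [q qn <-]].
  by exists q => //; apply: eq_bigr => v _; rewrite pq.
by exists (tail_law d s q) => //; split; [exact: tail_law_Delta|exists q].
Qed.

Lemma traj_values (g : S T -> R) :
  [set expect p (traj_outcome g) | p in ambiguity_set (T := T) d Q] =
  [set expect p (tail_outcome g (n := ord0)) | p in tail_laws d Q (n := ord0) tt].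
Proof.
rewrite tail_values eqEsubset; split=> [_ [p [_ [q q0 pq]] <-]|_ [q q0 <-]].
  exists q => //; rewrite -traj_law_expect.
  by apply: eq_bigr => v _; rewrite pq.
exists (traj_law (T := T) d q); first by split; [exact: traj_law_Delta|exists q].
exact: traj_law_expect.
Qed.

(** Feasible distributions vanish off the support, so the sum may run over all states. *)
Lemma stage_valuesE (n : nat) (s : stage_state S n) (W : S n -> R) :
  (n <= T)%N -> stage_values d Q supp s W = [set expect q W | q in Q s (d' s)].
Proof.
move=> nT; apply: eq_imagel => q Qq.
have [sub _ _ _ _] := feasibleQ nT s (d' s).
have [_ q0] := sub _ Qq; rewrite /expect big_mkcond /=.
by apply: eq_bigr => x _; case: ifPn => // /q0 ->; rewrite mul0r.
Qed.

Variable y : S T -> R.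

(** A single [q] serves every state [s]: a maximiser at the preceding stage then needs only one
    continuation, whichever state comes next. *)
Definition optimal (n : 'I_T.+1) (q : kernels) : Prop :=
  admissible T d Q n q /\
  forall s p, admissible T d Q n p ->
    expect (tail_law d s p) (tail_outcome y (n := n)) <=
    expect (tail_law d s q) (tail_outcome y (n := n)).

Lemma V_up_optimal (n : 'I_T.+1) (q : kernels) (s : stage_state S n) :
  optimal n q -> V_up d Q y s = expect (tail_law d s q) (tail_outcome y (n := n)).
Proof.
move=> [qn qopt]; rewrite /V_up tail_values; apply: sup_is_max.
by split=> [|_ [p pn <-]]; [exists q|exact: qopt].
Qed.

(* The witness follows [q1] after stage [n] and maximises the expectation of
   [W] at stage [n]. *)
Lemma greedy_optimal (n : 'I_T.+1) (W : S n -> R) (q1 : kernels) :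
  admissible T d Q n.+1 q1 ->
  (forall s p, admissible T d Q n p ->
    expect (tail_law d s p) (tail_outcome y (n := n)) <= expect (p n s (d' s)) W) ->
  (forall s p, (forall k, (n < k)%N -> p k = q1 k) ->
    expect (tail_law d s p) (tail_outcome y (n := n)) = expect (p n s (d' s)) W) ->
  exists2 q, optimal n q &
    forall s, is_max (stage_values d Q supp s W)
      (expect (tail_law d s q) (tail_outcome y (n := n))).
Proof.
move=> q1n ub_W eq_W; have nT : (n <= T)%N by rewrite -ltnS ltn_ord.
have /choice[f fP] (s : stage_state S n) :
    exists q, Q s (d' s) q /\ forall p, Q s (d' s) p -> expect p W <= expect q W.
  have [_ Q0 Qc _ _] := feasibleQ nT s (d' s).
  by have [q Qq qmax] := compact_expect_max W Q0 Qc; exists q.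
pose q : kernels :=
  @mathcomp_extra.dfwith _
    (fun k => stage_state S k -> stage_action A k -> S k -> R)
    q1 n (fun s _ => f s).
have qE s : q n s (d' s) = f s by rewrite /q dfwithin.
have q_q1 k : (n < k)%N -> q k = q1 k.
  by move=> nk; rewrite /q dfwithout // neq_ltn nk.
have qn : admissible T d Q n q.
  move=> k /andP[]; rewrite leq_eqVlt => /predU1P[<- _ s|nk kT s].
    by rewrite qE; exact: (fP s).1.
  by rewrite q_q1 //; apply: q1n; rewrite nk.
exists q; first split=> // s p pn.
  rewrite (eq_W s q q_q1) qE; apply: le_trans (ub_W s p pn) _.
  by apply: (fP s).2; apply: pn; rewrite leqnn.
move=> s; rewrite stage_valuesE // (eq_W s q q_q1) qE; split.
  by exists (f s) => //; exact: (fP s).1.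
by move=> _ [p Qp <-]; exact: (fP s).2.
Qed.

Lemma optimal_max : exists2 q, optimal ord_max q &
  forall s, is_max (stage_values d Q supp s y)
    (expect (tail_law d (n := ord_max) s q) (tail_outcome y (n := ord_max))).
Proof.
(* The zero kernels are a placeholder: admissibility from stage [T.+1] on is vacuous. *)
apply: (@greedy_optimal ord_max y (fun _ _ _ _ => 0)).
- by move=> n /andP[/= Tn nT]; have := leq_trans Tn nT; rewrite ltnn.
- by move=> s p _; rewrite expect_tail_law_max.
- by move=> s p _; rewrite expect_tail_law_max.
Qed.

Lemma optimal_src (t : 'I_T) (q1 : kernels) : optimal (tgt t) q1 ->
  exists2 q, optimal (src t) q &
  forall s, is_max (stage_values d Q supp s (fun s' => V_up d Q y (n := tgt t) s'))
    (expect (tail_law d (n := src t) s q) (tail_outcome y (n := src t))).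
Proof.
move=> q1opt; have [q1n q1max] := q1opt.
(* The continuation of any admissible [p] is worth at most [V_up] at each next state, with equality
   when [p] agrees with [q1] after stage [t]. *)
apply: (@greedy_optimal (src t) _ q1 q1n) => s p.
  move=> pn; rewrite expect_tail_law_src; apply: expect_le.
    by apply: (admissible_Delta s pn); rewrite leqnn (ltnW (ltn_ord t)).
  move=> s'; rewrite (V_up_optimal _ q1opt); apply: q1max.
  exact: admissible_leq pn.
move=> pq1; rewrite expect_tail_law_src; apply: eq_bigr => s' _.
rewrite (V_up_optimal _ q1opt); congr (_ * _).
apply: eq_bigr => v _; congr (_ * _).
by apply: eq_tail_law => k; exact: pq1.
Qed.

Lemma exists_optimal (n : 'I_T.+1) : exists q, optimal n q.
Proof.
elim/stage_ind: n => [|t [q1 /optimal_src[q qopt _]]]; last by exists q.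
by have [q qopt _] := optimal_max; exists q.
Qed.

Lemma V_up_max (s : stage_state S T) :
  is_max (stage_values d Q supp s y) (V_up d Q y (n := ord_max) s).
Proof. by have [q qopt qmax] := optimal_max; rewrite (V_up_optimal _ qopt). Qed.

Lemma V_up_src (t : 'I_T) (s : stage_state S t) :
  is_max (stage_values d Q supp s (fun s' : S t => V_up d Q y (n := tgt t) s'))
    (V_up d Q y (n := src t) s).
Proof.
have [q1 /optimal_src[q qopt qmax]] := exists_optimal (tgt t).
by rewrite (V_up_optimal (n := src t) _ qopt).
Qed.

End Bellman.

(** * Lower values from upper values by a change of sign *)

Section Duality.
Variables (R : realType) (T : nat) (A : finType) (S : nat -> finType).
Variables (supp : forall t, S t -> A -> {set S t.+1}).
Variables (d : forall t, S t -> A) (Q : set_family R A S) (y : S T -> R).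

Lemma V_lowE (n : 'I_T.+1) (s : stage_state S n) :
  V_low d Q y s = - V_up d Q (fun x => - y x) s.
Proof. exact: inf_expect. Qed.

Lemma is_min_stage_values (n : nat) (s : stage_state S n) (W : S n -> R) (m : R) :
  is_max (stage_values d Q supp s (fun s' => - W s')) m ->
  is_min (stage_values d Q supp s W) (- m).
Proof.
have sumN (q : S n -> R) (B : {set S n}) :
    \sum_(s' in B) q s' * - W s' = - \sum_(s' in B) q s' * W s'.
  by rewrite -sumrN; apply: eq_bigr => s' _; rewrite mulrN.
move=> [[q Qq <-] ubm]; split; first by exists q => //; rewrite sumN opprK.
move=> _ [p Qp <-]; rewrite lerNl -sumN; apply: ubm.
by exists p.
Qed.

End Duality.

(** * The recursion, its value at the root, and the default root set *)

Theorem theorem4p4 (R : realType) (T : nat) (A : finType) (S : nat -> finType)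
    (Y : set R) (y : S T -> R)
    (supp : forall t, S t -> A -> {set S t.+1}) (G : nat -> bool)
    (Mstar : scm R T A S) (d : forall t, S t -> A) (Q : set_family R A S)
    (T_gt0 : (1 <= T)%N) :
  finite_set Y -> (forall s, Y (y s)) ->
  (forall t, (t < T)%N -> forall s a, supp t s a != finset.set0) ->
  respects_supports Mstar supp -> respects_graph Mstar G ->
  feasible_family T supp (stage_kernel Mstar) Q ->
  [/\ (* t = T *)
      forall s : S T, V_up_T y s = y s /\ V_low_T y s = y s,
      (* t = T - 1 *)
      forall s : stage_state S T,
        is_max (stage_values d Q supp s (V_up_T y)) (V_up d Q y (n := ord_max) s) /\
        is_min (stage_values d Q supp s (V_low_T y)) (V_low d Q y (n := ord_max) s),
      (* t = n - 1 with 0 <= n < T *)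
      forall (n : 'I_T) (s : stage_state S n),
        is_max (stage_values d Q supp s (fun s' : S n => V_up d Q y (n := tgt n) s'))
               (V_up d Q y (n := src n) s) /\
        is_min (stage_values d Q supp s (fun s' : S n => V_low d Q y (n := tgt n) s'))
               (V_low d Q y (n := src n) s),
      V_up d Q y (n := ord0) tt = theta_up d Q y /\
      V_low d Q y (n := ord0) tt = theta_low d Q y
    & (* the index [tgt (Ordinal _)] is stage 1, i.e. t = 0 *)
      Q 0%N tt tt = [set obs_S0 Mstar] ->
        V_up d Q y (n := ord0) tt =
          \sum_(s0 : S 0%N) obs_S0 Mstar s0 * V_up d Q y (n := tgt (Ordinal T_gt0)) s0 /\
        V_low d Q y (n := ord0) tt =
          \sum_(s0 : S 0%N) obs_S0 Mstar s0 * V_low d Q y (n := tgt (Ordinal T_gt0)) s0].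
Proof.
move=> _ _ _ _ _ feasQ.
have VT s : V_up_T y s = y s /\ V_low_T y s = y s.
  have E : expect (point_mass R s) y = y s.
    rewrite /expect /point_mass (bigD1 s) //= eqxx mul1r big1 ?addr0 //.
    by move=> x /negPf ->; rewrite mul0r.
  by rewrite /V_up_T /V_low_T /terminal_laws !image_set1 E sup1 inf1.
have src_rec (n : 'I_T) (s : stage_state S n) :
  is_max (stage_values d Q supp s (fun s' : S n => V_up d Q y (n := tgt n) s'))
         (V_up d Q y (n := src n) s) /\
  is_min (stage_values d Q supp s (fun s' : S n => V_low d Q y (n := tgt n) s'))
         (V_low d Q y (n := src n) s).
  split; first exact: (V_up_src d feasQ).
  rewrite V_lowE; apply: is_min_stage_values.
  (* The negated lower continuation becomes the upper value for [- y], to which the upper recursion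
     applies. *)
  under [X in stage_values _ _ _ _ X]eq_fun do rewrite V_lowE opprK.
  exact: (V_up_src d feasQ).
split=> //.
- move=> s; have [-> ->] : V_up_T y = y /\ V_low_T y = y.
    by split; apply/funext => x; have [] := VT x.
  split; first exact: (V_up_max d feasQ).
  by rewrite V_lowE; apply: is_min_stage_values; exact: (V_up_max d feasQ).
- by rewrite /theta_up /theta_low (traj_values d feasQ).
(* The stage produced by [src] and [ord0] differ only in their bound proofs, which are identified
   here. *)
have V0 (p : (0 < T.+1)%N) :
    V_up d Q y (n := Ordinal p) tt = V_up d Q y (n := ord0) tt /\
    V_low d Q y (n := Ordinal p) tt = V_low d Q y (n := ord0) tt.
  by rewrite (bool_irrelevance p (ltn0Sn T)).
have [V_up0 V_low0] := V0 (widen_ord_proof (Ordinal T_gt0) (leqnSn T)).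
move=> Q0; have [] := src_rec (Ordinal T_gt0) tt.
rewrite /src /widen_ord V_up0 V_low0.
(* With a singleton root set there is one attainable value, so membership of the optimum gives the
   equation. *)
rewrite /stage_values /= Q0 !image_set1.
have setTE (F : S 0 -> R) : \sum_(s0 in [set: S 0]%SET) F s0 = \sum_s0 F s0.
  by apply: eq_bigl => s0; rewrite inE.
by rewrite !setTE => -[-> _] [-> _].
Qed.
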